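(* Let the valuation profile $V$ have an arbitrary joint distribution and let the horizon $N$ have an increasing failure rate (IFR). Let $m$ be the (left) median of $N$, let $S^{\mathrm{med}}$ be the feasible call set returned by the deterministic-horizon $(1-1/e)$-approximation algorithm run with budget $m$, and let $\pi^{\mathrm{med}}:=\pi^{\mathrm d}(S^{\mathrm{med}})$. Then the deterministic algorithm applied at the median $m$ achieves a $\tfrac14(1-\tfrac1e)$-approximation for the stochastic-horizon problem: $$\mathrm{Rev}(\pi^{\mathrm{med}})\;\ge\;\tfrac14\Big(1-\tfrac1e\Big)\,OPT^{\mathrm{IFR}},$$ where $OPT^{\mathrm{IFR}}$ is the optimal expected revenue over feasible plans under the random horizon $N$.
   Context: $I$ is a finite set of agents; $V=(V_i)_{i\in I}$ is a random vector in $\mathbb{R}_{\ge0}^I$ with an arbitrary (possibly correlated) known joint distribution. Each agent $i$ has a finite set $M_i\subset\mathbb{R}_{\ge0}$ of candidate prices. A call is a pair $e=(i_e,r_e)$ with $r_e\in M_{i_e}$; $\mathcal C$ is the set of calls. The horizon $N$ (number of available offers) is a nonnegative integer-valued random variable with known distribution, independent of $V$. It has increasing failure rate (IFR) if the discrete hazard $h(t)=\Pr[N=t\mid N\ge t]$ is nondecreasing in $t$. The (left) median $m$ of $N$ satisfies $\Pr[N\ge m]\ge\frac12$ and $\Pr[N\ge m+1]\le\frac12$. A plan is a finite sequence of calls $\pi=(e_1,\dots,e_k)$, $e_t=(i_t,r_t)$; it is feasible if each agent appears in at most one of its calls. Revenue: $$\mathrm{Rev}_n(\pi)=\mathbb{E}_V\Big[\sum_{t=1}^{\min(k,n)}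 r_t\,\mathbf 1\{V_{i_t}\ge r_t\}\prod_{s<t}\mathbf 1\{V_{i_s}<r_s\}\Big],\qquad \mathrm{Rev}(\pi)=\mathbb{E}_N[\mathrm{Rev}_N(\pi)].$$ $OPT^{\mathrm{IFR}}=\max_\pi\mathrm{Rev}(\pi)$ over feasible plans. For $S\subseteq\mathcal C$, $\pi^{\mathrm d}(S)$ lists the calls of $S$ in nonincreasing price order (arbitrary but fixed tie-breaking). The deterministic-horizon $(1-1/e)$-approximation algorithm with budget $m$ (continuous greedy on the multilinear extension followed by pipage rounding) returns a set $S^{\mathrm{med}}\subseteq\mathcal C$ with $|S^{\mathrm{med}}|\le m$, at most one call per agent, and $\mathrm{Rev}_m(\pi^{\mathrm d}(S^{\mathrm{med}}))\ge(1-1/e)\max_S\mathrm{Rev}_m(\pi^{\mathrm d}(S))$, the maximum being over $S\subseteq\mathcal C$ with $|S|\le m$ and at most one call per agent.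
   Formalization: The median m is assumed to be at least 1: for m = 0 the claim fails, e.g. N uniform on {0,1}, one agent with V = 1 and price 1, where the budget-0 plan earns 0 but the optimum is 1/2. *)

(* Defs.v *)
(* MathComp / MathComp-Analysis. *)
From HB Require Import structures.
From mathcomp Require Import all_boot all_order all_algebra.
From mathcomp Require Import finmap.
From mathcomp Require Import all_classical all_reals all_analysis.

Set Implicit Arguments.
Unset Strict Implicit.
Unset Printing Implicit Defensive.

Import Order.TTheory GRing.Theory Num.Theory.
Import numFieldNormedType.Exports.

Local Open Scope classical_set_scope.
Local Open Scope ring_scope.

Section Calls.
Context {R : realType} {I : finType}.
Variable M : I -> {fset R}.

Definition call : Type := {i : I & (M i : finType)}.

Definition agent (e : call) : I := tag e.
Definition price (e : call) : R := val (tagged e).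

Definition plan : Type := seq call.
Definition feasible (pi : plan) : bool := uniq (map agent pi).

Definition one_call_per_agent (S : {set call}) : bool :=
  [forall i, (#|[set e in S | agent e == i]| <= 1)%N].

(* Ties may be broken differently in different sets, so the specification covers
   in particular every fixed tie-breaking order on the calls. *)
Definition price_ordering (pid : {set call} -> plan) : Prop :=
  forall S : {set call},
    perm_eq (pid S) (enum S) /\ sorted (fun e f => price f <= price e) (pid S).

End Calls.

Section Probability.
Context {d : measure_display} {T : measurableType d} {R : realType}.
Variable P : probability T R.

(* Equals 0 when [P B = 0]. *)
Definition cond_prob (A B : set T) : R := fine (P (A `&` B)) / fine (P B).

(* The sigma-algebra generated by the random vector [V]. *)
Definition sigma_vector {I : finType} (V : I -> {RV P >-> R}) : set (set T) :=
  <<s [set A | exists i (B : set R), measurable B /\ A = V i @^-1` B] >>.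

Definition independent_of_vector {I : finType} (N : {RV P >-> nat})
    (V : I -> {RV P >-> R}) : Prop :=
  forall (A : set T) (B : set nat), sigma_vector V A ->
    P (A `&` (N @^-1` B)) = (P A * P (N @^-1` B))%E.

Definition hazard (N : {RV P >-> nat}) (t : nat) : R :=
  cond_prob [set w | N w = t] [set w | (t <= N w)%N].

(* The hazard is only meaningful at times [t] reached with positive probability,
   hence the guard. *)
Definition IFR (N : {RV P >-> nat}) : Prop :=
  forall s t : nat, (s <= t)%N -> (0 < P [set w | (t <= N w)%N])%E ->
    hazard N s <= hazard N t.

(* The left median is the least such [m]. *)
Definition is_median (N : {RV P >-> nat}) (m : nat) : Prop :=
  ((2^-1)%:E <= P [set w | (m <= N w)%N])%E /\
  (P [set w | (m.+1 <= N w)%N] <= (2^-1)%:E)%E.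

End Probability.

Section Revenue.
Context {d : measure_display} {T : measurableType d} {R : realType}.
Context {I : finType} (P : probability T R).
Variables (M : I -> {fset R}) (V : I -> {RV P >-> R}).

(* Calls are numbered from 0, so the first [minn (size pi) n] of them are those
   of index [t < n]. *)
Definition realized_revenue (n : nat) (pi : plan M) (w : T) : R :=
  \sum_(t < size pi | (t < n)%N)
    let e := tnth (in_tuple pi) t in
    price e * (price e <= V (agent e) w)%R%:R *
    \prod_(s < size pi | (s < t)%N)
      let f := tnth (in_tuple pi) s in (V (agent f) w < price f)%R%:R.

Definition Rev_fixed (n : nat) (pi : plan M) : R :=
  fine ('E_P[realized_revenue n pi])%E.

Definition Rev (N : {RV P >-> nat}) (pi : plan M) : R :=
  fine ('E_P[fun w => Rev_fixed (N w) pi])%E.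

(* A maximum, see [OPT_is_max]: only finitely many plans are feasible. *)
Definition OPT (N : {RV P >-> nat}) : R :=
  sup [set Rev N pi | pi in [set pi : plan M | feasible pi]].

Lemma finite_feasible : finite_set [set pi : plan M | feasible pi].
Proof.
pose k := #|{: call M}|.
apply: (@sub_finite_set _ _ [set val b | b in [set: k.-bseq (call M)]]).
  move=> pi /= feas_pi; have pi_uniq : uniq pi by exact: map_uniq feas_pi.
  have pi_size : (size pi <= k)%N by rewrite -(card_uniqP pi_uniq) max_card.
  by exists (Bseq pi_size).
exact/finite_image/finite_finset.
Qed.

Lemma OPT_is_max (N : {RV P >-> nat}) :
  (exists2 pi : plan M, feasible pi & Rev N pi = OPT N) /\
  (forall pi : plan M, feasible pi -> Rev N pi <= OPT N).
Proof.
have /finite_seqP [s feasE] := finite_feasible.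
have mem_s (pi : plan M) : feasible pi = (pi \in s).
  by apply/idP/idP => [h|h]; [have : [set` s] pi by rewrite -feasE|
     have : [set pi : plan M | feasible pi] pi by rewrite feasE].
have [pi pi_s pi_max] : exists2 pi, pi \in s &
    forall pi', pi' \in s -> Rev N pi' <= Rev N pi.
  have : s != [::] by apply/eqP => s0; have := mem_s [::]; rewrite s0 in_nil.
  elim: {mem_s feasE} s => // a s IHs _.
  have [->|/IHs [b b_s b_max]] := eqVneq s [::].
    by exists a; rewrite ?mem_head // => pi'; rewrite inE => /eqP ->.
  have [ab|/ltW ba] := leP (Rev N a) (Rev N b).
    exists b; first by rewrite inE b_s orbT.
    by move=> pi'; rewrite inE => /predU1P [->|/b_max].
  exists a; first by rewrite mem_head.
  by move=> pi'; rewrite inE => /predU1P [->|/b_max /le_trans]; [|apply].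
have OPTE : Rev N pi = OPT N.
  apply/le_anti/andP; split.
    apply: ub_le_sup; last by exists pi; rewrite //= mem_s.
    exists (Rev N pi) => _ [pi' feas_pi <-]. by apply: pi_max; rewrite -mem_s.
  apply: ge_sup; first by exists (Rev N pi), pi; rewrite //= mem_s.
  by move=> _ [pi' feas_pi <-]; apply: pi_max; rewrite -mem_s.
split; first by exists pi; rewrite ?mem_s.
by move=> pi'; rewrite mem_s -OPTE => /pi_max.
Qed.

(* The seed 0 of the iterated maximum is the revenue of the empty set. *)
Definition best_fixed (pid : {set call M} -> plan M) (m : nat) : R :=
  \big[Num.max/0]_(S : {set call M} | (#|S| <= m)%N && one_call_per_agent S)
    Rev_fixed m (pid S).

(* The output guarantee of the deterministic-horizon algorithm with budget [m]. *)
Definition deterministic_output (pid : {set call M} -> plan M) (m : nat)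
    (S : {set call M}) : Prop :=
  [/\ (#|S| <= m)%N, one_call_per_agent S
    & (1 - (expR 1)^-1) * best_fixed pid m <= Rev_fixed m (pid S)].

End Revenue.

(* Main.v *)
Require Import Defs.
From HB Require Import structures.
From mathcomp Require Import all_boot all_order all_algebra.
From mathcomp Require Import finmap.
From mathcomp Require Import all_classical all_reals all_analysis.
From mathcomp Require Import lra.
Import Order.TTheory GRing.Theory Num.Theory.
Import numFieldNormedType.Exports.
Local Open Scope classical_set_scope.
Local Open Scope ring_scope.

(** The proof compares both revenues with the number [F], the best revenue of a
    set of at most [m] calls (at most one per agent) under the fixed horizon
    [m], and only needs the survival function G(t) = P(N >= t) of the horizon.

    The mass of N at or beyond [m] already earns the plan of the algorithm
    Rev(pi_med) >= G(m) * Rev_m(pi_med) >= G(m) * (1 - 1/e) * F ([le_Rev]).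
    So it is enough that every feasible plan satisfies
    Rev(pi) <= 4 * G(m) * F.

    Fix a feasible plan and let the gain of its t-th call be the expected
    payment collected at that call. At most one call of the plan sells, so on
    any set A of calls the payments collected add up, pointwise, to at most the
    largest accepted price in A; listing A in nonincreasing price order collects
    exactly that price. Hence any [m] gains add up to at most [F]
    ([gain_subset_le]), and by averaging over [m]-subsets the first n > m gains
    add up to at most (n / m) * F ([average_share_le]). Taking expectations,
    Rev(pi) <= F * (1 + E[(N - m)^+] / m) = F * (1 + sum_(t > m) G(t) / m)
    ([Rev_le]).

    An increasing failure rate says that G is log-concave ([IFR_log_concave]),
    so that past [m] it decays at least as fast as a geometric sequence of ratio
    rho = G(m+1) / G(m), while rho ^ m <= G(m). With G(m+1) <= 1/2 <= G(m)
    this yields m + sum_(t > m) G(t) <= 4 * m * G(m) ([log_concave_tail]). The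
    crude bound E[(N - m)^+] <= m can fail, for instance for a geometric horizon
    with G(t) = 2 ^ (- t / 2) and m = 1. It is the excess of G(m) over 1/2 that
    compensates, which is why G(m) is kept on both sides and is not replaced
    by 1/2. *)

(** * Averages over subsets of given size *)

(** Averaging: each element of [B] lies in the same proportion m / #|B| of the
    [m]-subsets of [B]. The induction peels off one level at a time, summing
    the bound for [B :\ x] over all [x] in [B]. *)
Lemma average_share_le (R : realFieldType) (J : finType) (c : J -> R) (F : R)
    (m : nat) (B : {set J}) :
  (0 < m <= #|B|)%N ->
  (forall A : {set J}, A \subset B -> #|A| = m -> \sum_(j in A) c j <= F) ->
  m%:R * \sum_(j in B) c j <= #|B|%:R * F.
Proof.
case: m => // m; rewrite ltnS /=; have [n] := ubnP #|B|.
elim: n B => // n IHn B leBn lemB AF.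
have [Bm|Bm] := eqVneq #|B| m.+1.
  by rewrite Bm ler_pM2l ?ltr0n // AF // subxx.
have ltmB : (m.+1 < #|B|)%N by rewrite ltn_neqAle eq_sym Bm.
have cB1 x : x \in B -> #|B :\ x| = #|B|.-1.
  by move=> xB; rewrite (cardsD1 x B) xB.
have HB x : x \in B ->
    m.+1%:R * \sum_(j in B :\ x) c j <= #|B|.-1%:R * F.
  move=> xB; rewrite -(cB1 _ xB); apply: IHn.
  - by rewrite cB1 // -ltnS (ltn_predK ltmB).
  - by rewrite cB1 // -ltnS (ltn_predK ltmB).
  - by move=> A AB; apply: AF; rewrite (fintype.subset_trans AB) ?finset.subsetDl.
have := ler_sum (index_enum J) (P := fun x => x \in B) HB.
have sumB x : x \in B -> \sum_(j in B :\ x) c j = \sum_(j in B) c j - c x.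
  by move=> xB; rewrite [in RHS](big_setD1 x) //= addrC addrK.
rewrite -mulr_sumr (eq_bigr _ sumB) sumrB !sumr_const.
rewrite -(mulr_natr (\sum_(j in B) c j)) -[leRHS]mulr_natr.
have BE : #|B|%:R = #|B|.-1%:R + 1 :> R by rewrite natr1 (ltn_predK ltmB).
have B0 : 0 < #|B|.-1%:R :> R.
  by rewrite ltr0n -ltnS (ltn_predK ltmB) (leq_trans _ ltmB).
by move=> H; rewrite -(ler_pM2l B0); move: H; rewrite BE; lra.
Qed.

(** * Tails of log-concave survival functions *)

Lemma bernoulli_le (R : realFieldType) (x : R) k :
  0 <= x <= 1 -> 1 - k%:R * x <= (1 - x) ^+ k.
Proof.
move=> /andP[x0 x1]; elim: k => [|k IHk]; first by rewrite mul0r subr0 expr0.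
rewrite exprS -natr1.
have /(ler_wpM2l _) := IHk; move=> /(_ (1 - x)); rewrite subr_ge0 => /(_ x1).
apply: le_trans.
have : 0 <= k%:R * x * x by rewrite !mulr_ge0.
nra.
Qed.

(** The numerical core of the tail bound. Here [a] stands for G(m), [1 - x] for
    the ratio G(m+1) / G(m), and [S] for the tail sum, at most that of a
    geometric sequence. The constant 4 leaves little room for small [m]: at
    [m = 1] the two sides are 2.707 and 2.828 for [1 - x = a = 2 ^ (-1/2)]. *)
Lemma median_horizon_ineq (R : realFieldType) (a x y S : R) (m : nat) :
  (0 < m)%N -> y = m%:R * x -> 0 < x <= 1 ->
  2^-1 <= a -> a * (1 - x) <= 2^-1 -> (1 - x) ^+ m <= a ->
  x * S <= a * (1 - x) ->
  m%:R + S <= 4 * m%:R * a.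
Proof.
move=> m0 yE /andP[x0 x1] ha hax hxa hS.
have m1 : 1 <= m%:R :> R by rewrite ler1n.
have xy : x <= y by rewrite yE ler_peMl // ltW.
rewrite -(ler_pM2l x0) mulrDr.
suff : y + a * (1 - x) <= 4 * y * a by rewrite yE; lra.
have x01 : 0 <= x <= 1 by rewrite (ltW x0).
have ay : 1 - y <= a by rewrite yE; apply: le_trans (bernoulli_le _ _ m x01) hxa.
have y12 : 1 - (y + x) <= 2^-1.
  apply: le_trans hax; have := bernoulli_le _ _ m.+1 x01.
  rewrite -natr1 mulrDl mul1r -yE => /le_trans; apply.
  by rewrite exprSr ler_wpM2r // subr_ge0.
have [y2|y2] := leP 2^-1 y; first by nra.
(* After moving all terms to one side, the goal is affine in [a], with slope
   [4 * y - 1 + x >= 0], so it is worst at the lower end [a = 1 - y]. *)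
suff H : (1 - 2 * y) ^+ 2 <= (1 - y) * x.
  have : 0 <= (a - (1 - y)) * (4 * y - 1 + x) by apply: mulr_ge0; lra.
  by move: H; rewrite expr2; lra.
(* Bernoulli gives [1 - 2 * y <= 2 * x], which is enough once [y >= 1/3]; for
   [m = 1] it is too weak, and the exact value of the power is used. *)
have [m2|] := leqP 2 m.
  have m2R : 2 <= m%:R :> R by rewrite ler_nat.
  have xy2 : 2 * x <= y by rewrite yE ler_wpM2r // ltW.
  have y3 : 3^-1 <= y by lra.
  rewrite expr2; apply: (@le_trans _ _ (2 * x * (1 - 2 * y))).
    by apply: ler_wpM2r; lra.
  by rewrite mulrC mulrA ler_pM2r //; lra.
rewrite ltnS => m1'; have {m1'}mE : m = 1%N by apply/eqP; rewrite eqn_leq m1' m0.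
have {}yE : y = x by rewrite yE mE mul1r.
(* 7/25 is a rational just below the root [1 - 2 ^ (-1/2)] of
   [(1 - x) ^ 2 = 1/2], still close enough for [1 <= 5 * x * (1 - x)]. *)
subst y; have x7 : 7 / 25 <= x.
  rewrite leNgt; apply/negP => x7.
  have : (1 - x) * (1 - x) <= 2^-1 by apply: le_trans hax; rewrite ler_wpM2r //; lra.
  by nra.
by rewrite expr2; nra.
Qed.

Section LogConcaveTail.
Context {R : realFieldType} (G : nat -> R) (m : nat).
Hypotheses (m0 : (0 < m)%N) (G0 : G 0%N = 1) (Gge0 : forall t, 0 <= G t).
Hypothesis Gconc :
  forall s t, (s <= t)%N -> G t.+1 * G s <= G s.+1 * G t.
Hypotheses (Gm : 2^-1 <= G m) (Gm1 : G m.+1 <= 2^-1).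

(** By log-concavity the successive ratios of [G] are at least
    [rho := G m.+1 / G m] before [m] and at most [rho] after it. The first fact
    gives [rho ^+ m <= G m], the second a geometric tail. *)
Lemma log_concave_tail K :
  m%:R + \sum_(t < K | (m <= t)%N) G t.+1 <= 4 * m%:R * G m.
Proof.
have Gm0 : 0 < G m by apply: lt_le_trans Gm; rewrite invr_gt0.
pose rho := G m.+1 / G m.
have rho0 : 0 <= rho by rewrite divr_ge0.
have rhoE : G m * rho = G m.+1 by rewrite mulrC divfK // gt_eqF.
have rhopow s : (s <= m)%N -> rho ^+ s <= G s.
  elim: s => [|s IHs] lesm; first by rewrite G0.
  rewrite exprS; apply: (@le_trans _ _ (rho * G s)).
    by rewrite ler_wpM2l // IHs // ltnW.
  by rewrite -(ler_pM2r Gm0) mulrAC divfK ?gt_eqF // Gconc // ltnW.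
have rho1 : rho < 1.
  rewrite ltNge; apply/negP => rho1.
  have := exprn_ege1 m rho1; have := rhopow m (leqnn m).
  move=> /[swap] /le_trans /[apply] Gm_ge1.
  have := mulr_ege1 Gm_ge1 rho1; rewrite rhoE => /le_trans/(_ Gm1); lra.
have Gstep t : (m <= t)%N -> G t.+1 <= rho * G t.
  move=> lemt; rewrite -(ler_pM2r Gm0) [leRHS]mulrAC divfK ?gt_eqF //.
  exact: Gconc.
apply: (@median_horizon_ineq _ _ (1 - rho) (m%:R * (1 - rho))) => //.
- by rewrite subr_gt0 rho1 /= lerBlDr lerDl.
- by rewrite subKr rhoE.
- by rewrite subKr rhopow.
rewrite subKr rhoE.
(* Past [m], [(1 - rho) * G t.+1 <= G t.+1 - G t.+2], and the sum telescopes. *)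
suff : (1 - rho) * \sum_(t < K | (m <= t)%N) G t.+1
    <= G m.+1 - G (maxn m K).+1 by have := Gge0 (maxn m K).+1; lra.
elim: K => [|K IHK]; first by rewrite big_ord0 mulr0 maxn0 subrr.
rewrite -(big_mkord (fun t => (m <= t)%N) (fun t => G t.+1)).
have [leKm|ltmK] := ltnP K m.
  rewrite big_nat_cond big1 => [|t /andP[/andP[_ tK] mt]].
    by rewrite mulr0 (maxn_idPl _) // subrr.
  by have := leq_trans mt tK; rewrite leqNgt leKm.
rewrite big_mkcond big_nat_recr //= -big_mkcond big_mkord ltmK mulrDr.
rewrite (maxn_idPr (leqW ltmK)).
move: IHK; rewrite (maxn_idPr ltmK) => IHK.
have := Gstep K.+1 (leqW ltmK); lra.
Qed.
End LogConcaveTail.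

(** * Expectations of finite combinations of indicators *)

Section Indicators.
Context {d : measure_display} {T : measurableType d} {R : realType}.
Variable P : probability T R.

Lemma probability_fin (A : set T) : measurable A -> P A \is a fin_num.
Proof. by move=> mA; exact: fin_num_measure. Qed.

Lemma integrable_indic_sum (J : finType) (Q : pred J) (a : J -> R)
    (A : J -> set T) : (forall j, measurable (A j)) ->
  P.-integrable [set: T] (EFin \o (fun w => \sum_(j | Q j) a j * \1_(A j) w)).
Proof.
move=> mA; rewrite (_ : _ \o _ =
    fun w => (\sum_(j | Q j) ((a j)%:E * (\1_(A j) w)%:E)%E)%E); last first.
  by apply/funext => w /=; rewrite -sumEFin; apply: eq_bigr => j _; rewrite EFinM.
by apply: integrable_sum => // j _; apply: integrableZl => //; exact: integrable_indic.
Qed.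

Lemma expectation_indic_sum (J : finType) (Q : pred J) (a : J -> R)
    (A : J -> set T) : (forall j, measurable (A j)) ->
  fine ('E_P[fun w => (\sum_(j | Q j) a j * \1_(A j) w)%R])%E =
  \sum_(j | Q j) a j * fine (P (A j)).
Proof.
move=> mA; rewrite unlock.
have -> : (fun w => (\sum_(j | Q j) a j * \1_(A j) w)%:E) =
    fun w => (\sum_(j | Q j) ((a j)%:E * (\1_(A j) w)%:E)%E)%E.
  by apply/funext => w; rewrite -sumEFin; apply: eq_bigr => j _; rewrite EFinM.
rewrite integral_sum // => [|j]; last first.
  by apply: integrableZl => //; exact: integrable_indic.
rewrite (eq_bigr (fun j => (a j * fine (P (A j)))%:E)) => [|j _].
  by rewrite sumEFin.
rewrite integralZl //; last exact: integrable_indic.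
by rewrite integral_indic // setIT EFinM fineK // probability_fin.
Qed.

Lemma le_indic_sum (J K : finType) (Q : pred J) (S : pred K) (a : J -> R)
    (b : K -> R) (A : J -> set T) (B : K -> set T) (r : R) :
  (forall j, measurable (A j)) -> (forall k, measurable (B k)) ->
  (forall w, \sum_(j | Q j) a j * \1_(A j) w
             <= r + \sum_(k | S k) b k * \1_(B k) w) ->
  \sum_(j | Q j) a j * fine (P (A j)) <= r + \sum_(k | S k) b k * fine (P (B k)).
Proof.
move=> mA mB AB; rewrite -!expectation_indic_sum // unlock.
pose f w := \sum_(j | Q j) a j * \1_(A j) w.
pose g w := \sum_(k | S k) b k * \1_(B k) w.
rewrite -[fine (\int[P]_w (f w)%:E)%E]/(\int[P]_w f w).
rewrite -[fine (\int[P]_w (g w)%:E)%E]/(\int[P]_w g w).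
have -> : r = \int[P]_w (cst r w).
  by rewrite Rintegral_cst //= probability_setT mulr1.
rewrite -(@RintegralD _ _ _ P setT (cst r) g) //; last 2 first.
- exact: finite_measure_integrable_cst.
- exact: integrable_indic_sum.
apply: le_Rintegral => //; first exact: integrable_indic_sum.
  rewrite (_ : _ \o _ = (EFin \o cst r \+ EFin \o g)%E) //.
  apply: integrableD => //; last exact: integrable_indic_sum.
  exact: finite_measure_integrable_cst.
by move=> w _; exact: AB.
Qed.
End Indicators.

(** * The survival function of the horizon *)

Section Horizon.
Context {d : measure_display} {T : measurableType d} {R : realType}.
Context {P : probability T R} (N : {RV P >-> nat}).

Definition survival (t : nat) : R := fine (P [set w | (t <= N w)%N]).

Lemma measurable_horizon (B : set nat) : measurable (N @^-1` B).
Proof. by rewrite -[X in measurable X]setTI; exact: measurable_funP. Qed.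

Lemma measurable_tail (t : nat) : measurable [set w | (t <= N w)%N].
Proof. exact: (measurable_horizon [set n | (t <= n)%N]). Qed.

Lemma indic_tail t w : \1_[set w | (t <= N w)%N] w = (t <= N w)%:R :> R.
Proof. by rewrite indicE; congr ((nat_of_bool _)%:R); apply/idP/idP; rewrite inE. Qed.

Lemma survival0 : survival 0 = 1.
Proof.
rewrite /survival (_ : [set w | _] = setT) ?probability_setT //.
by apply/seteqP; split.
Qed.

Lemma survival_ge0 t : 0 <= survival t.
Proof. by rewrite fine_ge0. Qed.

Lemma survivalK t : (survival t)%:E = P [set w | (t <= N w)%N].
Proof. by rewrite fineK // probability_fin //; exact: measurable_tail. Qed.

Lemma le_survival s t : (s <= t)%N -> survival t <= survival s.
Proof.
move=> st; rewrite -lee_fin !survivalK le_measure ?inE //; try exact: measurable_tail.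
by move=> w /=; exact: leq_trans.
Qed.

Lemma hazard_survival t :
  hazard N t = (survival t - survival t.+1) / survival t.
Proof.
rewrite /hazard /cond_prob -/(survival t); congr (_ / _).
apply/eqP; rewrite eq_sym subr_eq; apply/eqP.
rewrite -[survival t]/(fine _) -[survival t.+1]/(fine _).
have mt : measurable (N @^-1` [set t]) by exact: measurable_horizon.
have E : [set w | N w = t] `&` [set w | (t <= N w)%N] = N @^-1` [set t].
  by apply/seteqP; split => w /= [] // <-.
rewrite E -fineD ?probability_fin //; last exact: measurable_tail.
rewrite -measureU //; last 2 first.
- exact: measurable_tail.
- by apply/seteqP; split => w //= [->]; rewrite ltnn.
congr (fine (P _)); apply/seteqP; split => w /=.
  by rewrite leq_eqVlt => /predU1P[->|]; [left|right].
by case=> [->//|/ltnW].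
Qed.

(** The hazard at [t] is [1 - survival t.+1 / survival t], so a nondecreasing
    hazard means nonincreasing ratios of survival probabilities. The form with
    products also covers the times past the support of the horizon. *)
Lemma IFR_log_concave : IFR N -> forall s t, (s <= t)%N ->
  survival t.+1 * survival s <= survival s.+1 * survival t.
Proof.
move=> ifr s t st; have [t0|] := eqVneq (survival t) 0.
  have -> : survival t.+1 = 0.
    by apply/le_anti; rewrite survival_ge0 -t0 le_survival.
  by rewrite mul0r mulr_ge0 // survival_ge0.
rewrite neq_lt ltNge survival_ge0 /= => t0.
have s0 := lt_le_trans t0 (le_survival _ _ st).
have := ifr s t st; rewrite -survivalK lte_fin => /(_ t0).
rewrite !hazard_survival ler_pdivrMr // mulrAC ler_pdivlMr //; lra.
Qed.
End Horizon.

(** * Sales and expected gains *)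

Section Sales.
Context {d : measure_display} {T : measurableType d} {R : realType}.
Context {I : finType} {P : probability T R}.
Context {M : I -> {fset R}} (V : I -> {RV P >-> R}).
Hypothesis M_ge0 : forall (i : I) (r : R), r \in M i -> 0 <= r.

Lemma price_ge0 (e : call M) : 0 <= price e.
Proof. exact: M_ge0 (valP (tagged e)). Qed.

Definition sale (pi : plan M) (t : 'I_(size pi)) : set T :=
  [set w | price (tnth (in_tuple pi) t) <= V (agent (tnth (in_tuple pi) t)) w]
  `&` \bigcap_(s in [set s : 'I_(size pi) | (s < t)%N])
    [set w | V (agent (tnth (in_tuple pi) s)) w < price (tnth (in_tuple pi) s)].

Definition gain (pi : plan M) (t : 'I_(size pi)) : R :=
  price (tnth (in_tuple pi) t) * fine (P (sale pi t)).

Lemma measurable_sale pi t : measurable (sale pi t).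
Proof.
apply: measurableI.
  by rewrite -[X in measurable X]setTI; exact: measurable_fun_le.
apply: fin_bigcap_measurable => [|s _]; first exact: finite_finset.
rewrite (_ : [set w | _] = ~` [set w | price (tnth (in_tuple pi) s) <=
    V (agent (tnth (in_tuple pi) s)) w]); last first.
  by apply/seteqP; split => w /=; rewrite ltNge => /negP.
apply: measurableC.
by rewrite -[X in measurable X]setTI; exact: measurable_fun_le.
Qed.

Lemma gain_ge0 pi t : 0 <= gain pi t.
Proof. by rewrite mulr_ge0 ?price_ge0 ?fine_ge0. Qed.

(** The earlier of two sales would have ended the process. *)
Lemma sale_uniq pi s t w : sale pi s w -> sale pi t w -> s = t.
Proof.
move=> [accs rejs] [acct rejt].
case: (ltngtP s t) => [lt_st|lt_ts|/val_inj //].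
  by have := rejt s lt_st; rewrite /= ltNge accs.
by have := rejs t lt_ts; rewrite /= ltNge acct.
Qed.

Lemma realized_revenueE n pi w : realized_revenue V n pi w =
  \sum_(t < size pi | (t < n)%N)
     price (tnth (in_tuple pi) t) * \1_(sale pi t) w.
Proof.
apply: eq_bigr => t _ /=; rewrite -mulrA; congr (_ * _).
rewrite indicE; have [/set_mem[acc rej]|nsale] := boolP (w \in sale pi t).
  by rewrite acc mul1r big1 // => s st; have /= -> := rej s st.
have [acc|] := boolP (price _ <= _); last by rewrite mul0r.
rewrite mul1r; have [[s st]|rej] := pselect (exists2 s : 'I_(size pi), (s < t)%N &
    ~~ (V (agent (tnth (in_tuple pi) s)) w < price (tnth (in_tuple pi) s))).
  by move=> /negbTE sF; rewrite (bigD1 s) //= sF mul0r.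
case/negP: nsale; apply/mem_set; split => // s st /=.
by apply/negPn/negP => ?; apply: rej; exists s.
Qed.

Lemma Rev_fixedE n pi :
  Rev_fixed V n pi = \sum_(t < size pi | (t < n)%N) gain pi t.
Proof.
rewrite /Rev_fixed (funext (realized_revenueE n pi)) expectation_indic_sum //.
exact: measurable_sale.
Qed.

(** Once the revenue is split according to the call that sells, the horizon
    enters only through the probability that the call is reached in time. *)
Lemma RevE (N : {RV P >-> nat}) pi :
  Rev V N pi = \sum_(t < size pi) gain pi t * survival N t.+1.
Proof.
rewrite /Rev; under [X in 'E_P[X]%E]eq_fun.
  move=> w; rewrite Rev_fixedE big_mkcond /=.
  rewrite (eq_bigr (fun t : 'I_(size pi) =>
      gain pi t * \1_[set w | (t.+1 <= N w)%N] w)); last first.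
    by move=> t _; rewrite indic_tail; case: ifP => _; rewrite ?mulr1 ?mulr0.
  over.
rewrite expectation_indic_sum // => t; exact: measurable_tail.
Qed.

(** In nonincreasing price order, the call that sells has the largest accepted
    price. *)
Lemma le_realized_sorted n (s : plan M) e w :
  sorted (fun e f => price f <= price e) s -> (size s <= n)%N -> e \in s ->
  price e <= V (agent e) w -> price e <= realized_revenue V n s w.
Proof.
move=> s_sorted sn es acc; pose a (f : call M) := price f <= V (agent f) w.
have has_a : has a s by apply/hasP; exists e.
have lt_i : (find a s < size s)%N by rewrite -has_find.
pose i := Ordinal lt_i.
have nthE (j : 'I_(size s)) : tnth (in_tuple s) j = nth e s j.
  by rewrite (tnth_nth e).
have sale_i : sale s i w.
  split=> [|j ji] /=; first by rewrite nthE; exact: (nth_find e has_a).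
  by rewrite nthE ltNge; apply/negbT; exact: (before_find e ji).
rewrite realized_revenueE (bigD1 i) /=; last exact: leq_trans lt_i sn.
rewrite indicE mem_set // mulr1 nthE /=.
apply: (@le_trans _ _ (price (nth e s (find a s)))); last first.
  by rewrite lerDl sumr_ge0 // => t _; rewrite mulr_ge0 ?price_ge0.
rewrite -{1}(nth_index e es).
apply: (@sorted_leq_nth _ (fun e f : call M => price f <= price e)) => //.
- by move=> x y z yx xz; exact: le_trans yx.
- by rewrite inE index_mem.
- by rewrite leqNgt; apply/negP => /(before_find e); rewrite nth_index // /a acc.
Qed.

(** The gains of a plan on a subset of its calls compete with offering just that
    subset by decreasing price: in each outcome at most one call of the plan
    sells, and its price is accepted, while the reordered subset sells at the
    largest accepted price. *)
Lemma gain_subset_le (pid : {set call M} -> plan M) (pi : plan M)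
    (A : {set 'I_(size pi)}) (m : nat) :
  price_ordering pid -> feasible pi -> (#|A| <= m)%N ->
  \sum_(t in A) gain pi t <= best_fixed V pid m.
Proof.
move=> pidP pi_feas Am.
pose S : {set call M} := [set tnth (in_tuple pi) t | t in A]%SET.
have [pidS sortS] := pidP S.
have Sm : (#|S| <= m)%N by rewrite (leq_trans (leq_imset_card _ _)).
have S1 : one_call_per_agent S.
  apply/forallP => i; rewrite leqNgt; apply/negP => /card_gt1P[e [f []]].
  rewrite !inE => /andP[/imsetP[s _ ->] /eqP ei] /andP[/imsetP[t _ ->] /eqP fi].
  apply/negP; rewrite negbK; apply/eqP; congr tnth; apply/val_inj => /=.
  have si : (s < size (map (@agent _ _ M) pi))%N by rewrite size_map.
  have ti : (t < size (map (@agent _ _ M) pi))%N by rewrite size_map.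
  apply/eqP; rewrite -(nth_uniq i si ti pi_feas).
  rewrite !(nth_map (tnth (in_tuple pi) s)) // -!(tnth_nth _ (in_tuple pi)).
  by rewrite ei -fi.
apply: (@le_trans _ _ (Rev_fixed V m (pid S))); last first.
  by apply: (le_bigmax_cond 0 (fun S => Rev_fixed V m (pid S))); rewrite Sm.
have sizeS : (size (pid S) <= m)%N by rewrite (perm_size pidS) -cardE.
rewrite Rev_fixedE -[leRHS]add0r; apply: le_indic_sum => [t|t|w].
- exact: measurable_sale.
- exact: measurable_sale.
rewrite add0r -realized_revenueE.
have revS0 : 0 <= realized_revenue V m (pid S) w.
  by rewrite realized_revenueE sumr_ge0 // => t _; rewrite mulr_ge0 ?price_ge0.
have [[t tA salet]|nosale] := pselect (exists2 t, t \in A & sale pi t w); last first.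
  rewrite big1 // => t tA; rewrite indicE memNset ?mulr0 // => ?.
  by apply: nosale; exists t.
rewrite (bigD1 t) //= big1 ?addr0 => [|s /andP[sA st]]; last first.
  rewrite indicE memNset ?mulr0 // => /sale_uniq/(_ salet) sE.
  by rewrite sE eqxx in st.
rewrite indicE mem_set // mulr1; apply: le_realized_sorted => //.
  by rewrite (perm_mem pidS) mem_enum; apply/imsetP; exists t.
by case: salet.
Qed.
End Sales.

(** * Comparison with the optimum at the median horizon *)

Lemma card_ord_lt (k m : nat) : (#|[set t : 'I_k | (t < m)%N]%SET| <= m)%N.
Proof.
rewrite cardE -(size_map val) -[leqRHS](size_iota 0); apply: uniq_leq_size.
  by rewrite map_inj_uniq ?enum_uniq //; exact: val_inj.
by move=> _ /mapP[t + ->]; rewrite mem_enum inE mem_iota.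
Qed.

Section Comparison.
Context {d : measure_display} {T : measurableType d} {R : realType}.
Context {I : finType} {P : probability T R}.
Context {M : I -> {fset R}} (V : I -> {RV P >-> R}) (N : {RV P >-> nat}).
Hypothesis M_ge0 : forall (i : I) (r : R), r \in M i -> 0 <= r.

(** Serving [n > m] calls is worth at most [n / m] times the best [m] calls. The
    second factor on the right is the number of calls of the plan within the
    horizon, or [m] if that is larger; as [m] plus a count of calls, it has an
    expectation given by survival probabilities. *)
Lemma prefix_revenue_le (pid : {set call M} -> plan M) (pi : plan M) (m n : nat) :
  price_ordering pid -> feasible pi -> (0 < m)%N ->
  m%:R * Rev_fixed V n pi <= best_fixed V pid m *
    (m + #|[set t : 'I_(size pi) | (m <= t < n)%N]%SET|)%:R.
Proof.
move=> pidP pi_feas m0; set E := [set t | _]%SET.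
set F := best_fixed V pid m.
have F0 : 0 <= F by exact: bigmax_ge_id.
pose B := [set t : 'I_(size pi) | (t < n)%N]%SET.
have -> : Rev_fixed V n pi = \sum_(t in B) gain V pi t.
  by rewrite Rev_fixedE; apply: eq_bigl => t; rewrite inE.
have cardB : (#|B| <= m + #|E|)%N.
  apply: leq_trans (leq_add (card_ord_lt (size pi) m) (leqnn _)).
  apply: leq_trans (leq_card_setU _ _); apply/subset_leq_card/fintype.subsetP => t.
  by rewrite !inE => ->; rewrite andbT; case: ltnP.
have subF (A : {set 'I_(size pi)}) : (#|A| <= m)%N -> \sum_(t in A) gain V pi t <= F.
  exact: gain_subset_le.
have [Bm|/ltnW mB] := leqP #|B| m.
  rewrite mulrC ler_pM ?ler0n ?subF // ?ler_nat ?leq_addr //.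
  by apply: sumr_ge0 => t _; exact: gain_ge0.
apply: (@le_trans _ _ (#|B|%:R * F)); last by rewrite mulrC ler_wpM2l // ler_nat.
by apply: average_share_le => [|A _ Am]; rewrite ?m0 // subF // Am.
Qed.

Lemma Rev_le (pid : {set call M} -> plan M) (pi : plan M) (m : nat) :
  price_ordering pid -> feasible pi -> (0 < m)%N ->
  m%:R * Rev V N pi <= best_fixed V pid m *
    (m%:R + \sum_(t < size pi | (m <= t)%N) survival N t.+1).
Proof.
move=> pidP pi_feas m0; rewrite RevE mulr_sumr mulrDr mulr_sumr.
under eq_bigr do rewrite mulrA.
apply: le_indic_sum => [t|t|w]; try exact: measurable_tail.
have := prefix_revenue_le pid pi m (N w) pidP pi_feas m0.
rewrite Rev_fixedE mulr_sumr natrD mulrDr => H.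
rewrite (eq_bigr (fun t : 'I_(size pi) =>
    if (t < N w)%N then m%:R * gain V pi t else 0)) => [|t _]; last first.
  by rewrite indic_tail; case: ifP => _; rewrite ?mulr1 ?mulr0.
rewrite -big_mkcond; apply: le_trans H _; rewrite lerD2l -sum1_card natr_sum mulr_sumr.
rewrite big_mkcond [leRHS]big_mkcond ler_sum // => t _.
rewrite !inE indic_tail; case: (m <= t)%N => //=.
by case: (t < N w)%N; rewrite ?mulr1 ?mulr0.
Qed.

Lemma le_Rev (pi : plan M) (m : nat) :
  survival N m * Rev_fixed V m pi <= Rev V N pi.
Proof.
rewrite Rev_fixedE RevE mulr_sumr big_mkcond ler_sum // => t _.
case: ifP => [tm|_]; last by rewrite mulr_ge0 ?gain_ge0 ?survival_ge0.
by rewrite mulrC ler_wpM2l ?gain_ge0 // le_survival.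
Qed.
End Comparison.

Theorem theorem6 (R : realType) (d : measure_display) (T : measurableType d)
    (P : probability T R) (I : finType)
    (V : I -> {RV P >-> R}) (V_ge0 : forall (i : I) (w : T), 0 <= V i w)
    (M : I -> {fset R}) (M_ge0 : forall (i : I) (r : R), r \in M i -> 0 <= r)
    (N : {RV P >-> nat}) (N_indep : independent_of_vector N V) (N_IFR : IFR N)
    (m : nat) (m_gt0 : (0 < m)%N) (m_median : is_median N m)
    (pid : {set call M} -> plan M) (pid_ordering : price_ordering pid)
    (Smed : {set call M}) (Smed_output : deterministic_output V pid m Smed) :
  4^-1 * (1 - (expR 1)^-1) * OPT M V N <= Rev V N (pid Smed).
Proof.
have [_ _ alg] := Smed_output.
have [[pi pi_feas <-] _] := OPT_is_max M V N.
case: m_median; rewrite -!survivalK !lee_fin => Gm Gm1.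
set F := best_fixed V pid m in alg *.
have F0 : 0 <= F by exact: bigmax_ge_id.
have tail := log_concave_tail (survival N) m m_gt0 (survival0 N) (survival_ge0 N)
  (IFR_log_concave N N_IFR) Gm Gm1 (size pi).
have m0 : 0 < m%:R :> R by rewrite ltr0n.
have RevF : 4^-1 * Rev V N pi <= survival N m * F.
  rewrite -(ler_pM2l m0); have := Rev_le V N M_ge0 pid pi m pid_ordering pi_feas m_gt0.
  rewrite -/F; have := ler_wpM2l F0 tail; lra.
have e0 : 0 <= 1 - (expR 1)^-1 :> R.
  by rewrite subr_ge0 invf_le1 ?expR_gt0 // -expR0 ler_expR.
apply: le_trans (le_Rev V N M_ge0 (pid Smed) m).
apply: (@le_trans _ _ (survival N m * ((1 - (expR 1)^-1) * F))).
  by rewrite mulrAC [leRHS]mulrCA [leRHS]mulrC ler_wpM2r.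
by rewrite ler_wpM2l // survival_ge0.
Qed.
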